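(* Let $\gamma(t)=\Psi(u(t),v(t))$ be a regular curve in $\mathbb{S}^2_+$. Then $\gamma$ is a spherical catenary (with parameter $\lambda\in\mathbb{R}$) if and only if its curvature $\kappa_s$ satisfies $$\kappa_s=\frac{v'\cos u}{(u+\lambda)\,|\gamma'|}.$$
   Context: $\mathbb{S}^2=\{(x,y,z)\in\mathbb{R}^3: x^2+y^2+z^2=1\}$ and $\mathbb{S}^2_+=\{(x,y,z)\in\mathbb{S}^2: z>0\}$. The parametrization is $\Psi(u,v)=(\cos u\cos v,\cos u\sin v,\sin u)$, $u\in[-\pi/2,\pi/2]$, $v\in\mathbb{R}$; for a curve $\gamma:[a,b]\to\mathbb{S}^2_+$, $\gamma(t)=\Psi(u(t),v(t))$, one has $u(t)\in(0,\pi/2]$. Regular means $\gamma'(t)\ne 0$ for all $t$, and $|\gamma'|=\sqrt{u'^2+v'^2\cos^2u}$. For a curve $\gamma=\Psi(u,v)$ in $\mathbb{S}^2_+$, $u$ is its spherical distance to the geodesic $P=\{z=0\}\cap\mathbb{S}^2$, and the potential energy is $$\mathcal{E}_S[\gamma]=\int_a^b (u+\lambda)|\gamma'(t)|\,dt=\int_a^b(u+\lambda)\sqrt{u'^2+v'^2\cos^2u}\,dt,$$ where $\lambda\in\mathbb{R}$ is a constant (a Lagrange multiplier). A spherical catenary is a critical point of $\mathcal{E}_S$ (for variations with fixed endpoints), i.e. $(u,v)$ satisfies both Euler–Lagrange equations $\frac{\partial J}{\partial u}-\frac{d}{dt}\frac{\partial J}{\partial u'}=0$, $\frac{\partial J}{\partial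 v}-\frac{d}{dt}\frac{\partial J}{\partial v'}=0$ of the Lagrangian $J=(u+\lambda)\sqrt{u'^2+v'^2\cos^2u}$. The curvature $\kappa_s$ is the geodesic curvature of $\gamma$ in $\mathbb{S}^2$, computed with the orientation $N(p)=-p$ of $\mathbb{S}^2$: $\kappa_s=\dfrac{\langle\gamma,\gamma'\times\gamma''\rangle}{|\gamma'|^3}$. *)

(* Defs.v *)
From Stdlib Require Import Reals.
From Coquelicot Require Import Coquelicot.

Open Scope R_scope.

Definition vec3 : Type := (R * R * R)%type.

Definition vx (p : vec3) : R := fst (fst p).
Definition vy (p : vec3) : R := snd (fst p).
Definition vz (p : vec3) : R := snd p.

Definition dot (p q : vec3) : R := vx p * vx q + vy p * vy q + vz p * vz q.

Definition cross (p q : vec3) : vec3 :=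
  (vy p * vz q - vz p * vy q,
   vz p * vx q - vx p * vz q,
   vx p * vy q - vy p * vx q).

Definition vnorm (p : vec3) : R := sqrt (dot p p).

Definition vderive (g : R -> vec3) (t : R) : vec3 :=
  (Derive (fun s => vx (g s)) t,
   Derive (fun s => vy (g s)) t,
   Derive (fun s => vz (g s)) t).

Definition in_S2_plus (p : vec3) : Prop :=
  vx p ^ 2 + vy p ^ 2 + vz p ^ 2 = 1 /\ 0 < vz p.

Definition Psi (u v : R) : vec3 := (cos u * cos v, cos u * sin v, sin u).

(* Class C^2 on a neighbourhood of [a, b]: [Derive] is two-sided, so the values
   at the end points are those of a C^2 extension past them; the derivatives up
   to order 2 at a and b do not depend on the extension. *)
Definition C2_on (a b : R) (f : R -> R) : Prop :=
  forall t, a <= t <= b ->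
    locally t (fun s =>
      ex_derive f s /\ ex_derive (Derive f) s /\
      continuous (Derive (Derive f)) s).

Definition curve_in_S2_plus (a b : R) (u v : R -> R) : Prop :=
  C2_on a b u /\ C2_on a b v /\
  forall t, a <= t <= b ->
    - PI / 2 <= u t <= PI / 2 /\ in_S2_plus (Psi (u t) (v t)).

Definition regular (a b : R) (g : R -> vec3) : Prop :=
  forall t, a <= t <= b -> vderive g t <> (0, 0, 0).

(* Geodesic curvature in S^2 for the orientation N(p) = - p. *)
Definition kappa_s (g : R -> vec3) (t : R) : R :=
  dot (g t) (cross (vderive g t) (vderive (vderive g) t))
  / vnorm (vderive g t) ^ 3.

(* Euler-Lagrange equations at t of the integral of L(u, v, u', v') dt. *)
Definition Euler_Lagrange_u (L : R -> R -> R -> R -> R) (u v : R -> R) (t : R)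
  : Prop :=
  Derive (fun x => L x (v t) (Derive u t) (Derive v t)) (u t)
  - Derive (fun s => Derive (fun p => L (u s) (v s) p (Derive v s)) (Derive u s)) t
  = 0.

Definition Euler_Lagrange_v (L : R -> R -> R -> R -> R) (u v : R -> R) (t : R)
  : Prop :=
  Derive (fun y => L (u t) y (Derive u t) (Derive v t)) (v t)
  - Derive (fun s => Derive (fun q => L (u s) (v s) (Derive u s) q) (Derive v s)) t
  = 0.

(* Integrand of the potential energy (p and q stand for u' and v'): u is the
   spherical distance to the equator, the square root is |gamma'|. *)
Definition J (lambda u v p q : R) : R :=
  (u + lambda) * sqrt (p ^ 2 + q ^ 2 * cos u ^ 2).

Definition spherical_catenary (lambda a b : R) (u v : R -> R) : Prop :=
  forall t, a <= t <= b ->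
    Euler_Lagrange_u (J lambda) u v t /\ Euler_Lagrange_v (J lambda) u v t.

(* Main.v *)
(* Write m = u + lambda and R = v' cos u |gamma'|^2 - m kappa_s |gamma'|^3
   ([defect] below). The two Euler-Lagrange expressions equal
   v' cos u R / |gamma'|^3 and - u' cos u R / |gamma'|^3. Interior points have
   cos u <> 0, so on ]a, b[ the two equations amount to R = 0, and by continuity
   they do on [a, b]. Where m <> 0, R = 0 is the curvature equation; where m = 0,
   that equation reads kappa_s = 0 because of the convention x / 0 = 0, and it
   agrees with R = 0 only thanks to the equations at the other points. *)

Require Import Defs.
From Stdlib Require Import Reals Lra Classical_Prop.
From Corelib Require Import ssreflect.
From Coquelicot Require Import Coquelicot.

Open Scope R_scope.

(** [auto_derive] leaves eta-expanded functions under [Derive]; contracting them lets [ring]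
    recognise equal atoms. *)
Ltac eta_reduce :=
  repeat match goal with
  | |- context [fun x => ?f x] => progress change (fun x => f x) with f
  end.

(** * Pointwise regularity and the quantities attached to the curve *)

Definition C2_at (f : R -> R) (t : R) : Prop :=
  locally t (fun s =>
    ex_derive f s /\ ex_derive (Derive f) s /\
    continuous (Derive (Derive f)) s).

Definition speed2 (u v : R -> R) (t : R) : R :=
  Derive u t ^ 2 + Derive v t ^ 2 * cos (u t) ^ 2.

(* [kappa_s] times the cube of the speed. *)
Definition curvature_num (u v : R -> R) (t : R) : R :=
  Derive v t * cos (u t)
    * (Derive (Derive u) t + Derive v t ^ 2 * sin (u t) * cos (u t))
  - Derive u t
    * (Derive (Derive v) t * cos (u t) - 2 * Derive u t * Derive v t * sin (u t)).

Definition defect (lambda : R) (u v : R -> R) (t : R) : R :=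
  Derive v t * cos (u t) * speed2 u v t - (u t + lambda) * curvature_num u v t.

Lemma sin2_eq (x : R) : sin x ^ 2 = 1 - cos x ^ 2.
Proof. generalize (sin2_cos2 x); unfold Rsqr; intros H; simpl; lra. Qed.

Lemma C2_at_jet (f : R -> R) (t : R) (Hf : C2_at f t) :
  ex_derive f t /\ ex_derive (Derive f) t /\ continuous (Derive (Derive f)) t.
Proof. exact (locally_singleton _ _ Hf). Qed.

Lemma C2_at_ex_derive (f : R -> R) (t : R) (Hf : C2_at f t) :
  locally t (fun s => ex_derive f s).
Proof. apply: filter_imp Hf; tauto. Qed.

(** * Velocity, speed and geodesic curvature in the coordinates u, v *)

Lemma vderive_Psi (u v : R -> R) (t : R) (Hu : ex_derive u t) (Hv : ex_derive v t) :
  vderive (fun s => Psi (u s) (v s)) t =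
  (- Derive u t * sin (u t) * cos (v t) - Derive v t * cos (u t) * sin (v t),
   - Derive u t * sin (u t) * sin (v t) + Derive v t * cos (u t) * cos (v t),
   Derive u t * cos (u t)).
Proof.
unfold vderive, Psi, vx, vy, vz; simpl.
f_equal; [f_equal|]; apply is_derive_unique; auto_derive; try tauto; eta_reduce; ring.
Qed.

Lemma dot_vderive_Psi (u v : R -> R) (t : R) (Hu : ex_derive u t) (Hv : ex_derive v t) :
  dot (vderive (fun s => Psi (u s) (v s)) t) (vderive (fun s => Psi (u s) (v s)) t)
  = speed2 u v t.
Proof.
rewrite vderive_Psi; trivial.
unfold dot, speed2, vx, vy, vz; simpl fst; simpl snd.
ring_simplify; rewrite !sin2_eq; ring.
Qed.

Lemma speed2_pos (u v : R -> R) (t : R) (Hu : ex_derive u t) (Hv : ex_derive v t)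
    (Hr : vderive (fun s => Psi (u s) (v s)) t <> (0, 0, 0)) :
  0 < speed2 u v t.
Proof.
assert (H0 : 0 <= speed2 u v t).
{ unfold speed2; apply Rplus_le_le_0_compat; [|apply Rmult_le_pos]; apply pow2_ge_0. }
destruct H0 as [H0|H0]; trivial; exfalso; apply Hr.
rewrite vderive_Psi; trivial.
unfold speed2 in H0.
assert (A := pow2_ge_0 (Derive u t)).
assert (B := pow2_ge_0 (Derive v t * cos (u t))).
rewrite Rpow_mult_distr in B.
assert (Hp : Derive u t = 0).
{ apply Rsqr_0_uniq; unfold Rsqr; lra. }
assert (Hq : Derive v t * cos (u t) = 0).
{ apply Rsqr_0_uniq; unfold Rsqr; lra. }
rewrite Hp Hq; f_equal; [f_equal|]; ring.
Qed.

(** In the orthonormal tangent frame of the meridian and parallel directions, the velocity is (u',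
    v' cos u) and the tangential acceleration (u'' + v'^2 sin u cos u, v'' cos u - 2 u' v' sin u).
    The triple product is minus the determinant of these pairs, since the cross product of the two
    frame vectors is - [Psi]. *)
Lemma kappa_s_Psi (u v : R -> R) (t : R) (Hu : C2_at u t) (Hv : C2_at v t) :
  kappa_s (fun s => Psi (u s) (v s)) t
  = curvature_num u v t / sqrt (speed2 u v t) ^ 3.
Proof.
destruct (C2_at_jet _ _ Hu) as [Hu1 [Hu2 _]].
destruct (C2_at_jet _ _ Hv) as [Hv1 [Hv2 _]].
(* Differentiating once more needs the velocity formula on a neighbourhood of t. *)
assert (Hloc : locally t (fun s => vderive (fun s => Psi (u s) (v s)) s =
  (- Derive u s * sin (u s) * cos (v s) - Derive v s * cos (u s) * sin (v s),
   - Derive u s * sin (u s) * sin (v s) + Derive v s * cos (u s) * cos (v s),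
   Derive u s * cos (u s)))).
{ generalize (filter_and _ _ (C2_at_ex_derive _ _ Hu) (C2_at_ex_derive _ _ Hv)).
  apply filter_imp; intros s [? ?]; apply vderive_Psi; trivial. }
unfold kappa_s, vnorm; rewrite dot_vderive_Psi //.
f_equal.
set (g := vderive (fun s => Psi (u s) (v s))) in *.
assert (Hg : vderive g t =
 (- Derive (Derive u) t * sin (u t) * cos (v t) - Derive u t ^ 2 * cos (u t) * cos (v t)
  + 2 * Derive u t * Derive v t * sin (u t) * sin (v t)
  - Derive (Derive v) t * cos (u t) * sin (v t) - Derive v t ^ 2 * cos (u t) * cos (v t),
  - Derive (Derive u) t * sin (u t) * sin (v t) - Derive u t ^ 2 * cos (u t) * sin (v t)
  - 2 * Derive u t * Derive v t * sin (u t) * cos (v t)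
  + Derive (Derive v) t * cos (u t) * cos (v t) - Derive v t ^ 2 * cos (u t) * sin (v t),
  Derive (Derive u) t * cos (u t) - Derive u t ^ 2 * sin (u t))).
{ unfold vderive; f_equal; [f_equal|].
  - rewrite (Derive_ext_loc _ (fun s =>
      - Derive u s * sin (u s) * cos (v s) - Derive v s * cos (u s) * sin (v s))).
    + apply is_derive_unique; auto_derive; [tauto|].
      eta_reduce; ring.
    + revert Hloc; apply filter_imp; intros s ->; reflexivity.
  - rewrite (Derive_ext_loc _ (fun s =>
      - Derive u s * sin (u s) * sin (v s) + Derive v s * cos (u s) * cos (v s))).
    + apply is_derive_unique; auto_derive; [tauto|].
      eta_reduce; ring.
    + revert Hloc; apply filter_imp; intros s ->; reflexivity.
  - rewrite (Derive_ext_loc _ (fun s => Derive u s * cos (u s))).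
    + apply is_derive_unique; auto_derive; [tauto|].
      eta_reduce; ring.
    + revert Hloc; apply filter_imp; intros s ->; reflexivity. }
rewrite Hg (locally_singleton _ _ Hloc).
unfold dot, cross, Psi, curvature_num, vx, vy, vz; simpl fst; simpl snd.
generalize (sin2_eq (u t)) (sin2_eq (v t)).
set (s := sin (u t)); set (c := cos (u t)); set (s' := sin (v t)); set (c' := cos (v t)).
intros Es Es'.
(* Higher powers of the sines are lowered by sin^2 = 1 - cos^2, which leaves a polynomial
   identity. *)
ring_simplify;
replace (s ^ 4) with ((s^2)^2) by ring; replace (s^3) with (s^2*s) by ring;
replace (s' ^ 4) with ((s'^2)^2) by ring; replace (s'^3) with (s'^2*s') by ring;
rewrite Es Es'; ring.
Qed.

(** * Euler-Lagrange equations in terms of the defect *)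

Lemma is_derive_speed2 (u v : R -> R) (t : R) (Hu : C2_at u t) (Hv : C2_at v t) :
  is_derive (speed2 u v) t
   (2 * (Derive u t * Derive (Derive u) t + Derive v t * Derive (Derive v) t * cos (u t) ^ 2
    - Derive v t ^ 2 * cos (u t) * sin (u t) * Derive u t)).
Proof.
destruct (C2_at_jet _ _ Hu) as [Hu1 [Hu2 _]].
destruct (C2_at_jet _ _ Hv) as [Hv1 [Hv2 _]].
unfold speed2; auto_derive; [tauto|].
eta_reduce; ring.
Qed.

(** The closed forms of the partial derivatives of [J] need positive speed. They are differentiated
    in t, so they must hold around t, also when t is an end point of the interval. *)
Lemma locally_speed2_pos (u v : R -> R) (t : R) (Hu : C2_at u t) (Hv : C2_at v t)
    (Hs : 0 < speed2 u v t) :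
  locally t (fun s => 0 < speed2 u v s).
Proof.
assert (Hc : continuous (speed2 u v) t).
{ apply (@ex_derive_continuous R_AbsRing R_NormedModule).
  eexists; exact: is_derive_speed2. }
apply: (Hc (fun x : R => 0 < x)); exact: (open_gt 0 _ Hs).
Qed.

Lemma Derive_J_u (lambda x y p q : R) (Hs : 0 < p ^ 2 + q ^ 2 * cos x ^ 2) :
  Derive (fun x => J lambda x y p q) x
  = sqrt (p ^ 2 + q ^ 2 * cos x ^ 2)
    - (x + lambda) * (q ^ 2 * cos x * sin x) / sqrt (p ^ 2 + q ^ 2 * cos x ^ 2).
Proof.
unfold J; apply is_derive_unique; auto_derive; [simpl in *; lra|].
assert (0 < sqrt (p ^ 2 + q ^ 2 * cos x ^ 2)) by (apply sqrt_lt_R0; trivial).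
cbn [pow] in *; field; lra.
Qed.

Lemma Derive_J_p (lambda x y p q : R) (Hs : 0 < p ^ 2 + q ^ 2 * cos x ^ 2) :
  Derive (fun p => J lambda x y p q) p
  = (x + lambda) * p / sqrt (p ^ 2 + q ^ 2 * cos x ^ 2).
Proof.
unfold J; apply is_derive_unique; auto_derive; [simpl in *; lra|].
assert (0 < sqrt (p ^ 2 + q ^ 2 * cos x ^ 2)) by (apply sqrt_lt_R0; trivial).
cbn [pow] in *; field; lra.
Qed.

Lemma Derive_J_q (lambda x y p q : R) (Hs : 0 < p ^ 2 + q ^ 2 * cos x ^ 2) :
  Derive (fun q => J lambda x y p q) q
  = (x + lambda) * q * cos x ^ 2 / sqrt (p ^ 2 + q ^ 2 * cos x ^ 2).
Proof.
unfold J; apply is_derive_unique; auto_derive; [simpl in *; lra|].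
assert (0 < sqrt (p ^ 2 + q ^ 2 * cos x ^ 2)) by (apply sqrt_lt_R0; trivial).
cbn [pow] in *; field; lra.
Qed.

(** The conjugate momenta along the curve: the partial derivative of [J] in u' here, in v' for
    [momentum_v]. *)
Definition momentum_u (lambda : R) (u v : R -> R) (t : R) : R :=
  (u t + lambda) * Derive u t / sqrt (speed2 u v t).

Definition momentum_v (lambda : R) (u v : R -> R) (t : R) : R :=
  (u t + lambda) * Derive v t * cos (u t) ^ 2 / sqrt (speed2 u v t).

(** The first two terms are the partial derivative of [J] in u, so the last one is minus the
    Euler-Lagrange expression. *)
Lemma is_derive_momentum_u (lambda : R) (u v : R -> R) (t : R)
    (Hu : C2_at u t) (Hv : C2_at v t) (Hs : 0 < speed2 u v t) :
  is_derive (momentum_u lambda u v) t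
    (sqrt (speed2 u v t)
     - (u t + lambda) * (Derive v t ^ 2 * cos (u t) * sin (u t)) / sqrt (speed2 u v t)
     - Derive v t * cos (u t) * defect lambda u v t / sqrt (speed2 u v t) ^ 3).
Proof.
destruct (C2_at_jet _ _ Hu) as [Hu1 [Hu2 _]].
destruct (C2_at_jet _ _ Hv) as [Hv1 [Hv2 _]].
assert (Hd := is_derive_speed2 _ _ _ Hu Hv).
assert (Hw : 0 < sqrt (speed2 u v t)) by (apply sqrt_lt_R0; trivial).
unfold momentum_u; auto_derive.
- repeat split; trivial; [eexists; exact Hd | lra].
- eta_reduce.
  rewrite (is_derive_unique _ _ _ Hd).
  unfold defect, curvature_num.
  assert (Ew : sqrt (speed2 u v t) ^ 2 = speed2 u v t) by (rewrite pow2_sqrt //; lra).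
  set (w := sqrt (speed2 u v t)) in *.
  field_simplify_eq; [|lra].
  replace (w ^ 4) with (w ^ 2 * w ^ 2) by ring.
  rewrite Ew; unfold speed2; ring.
Qed.

(** Since [J] does not depend on v, this derivative is the whole Euler-Lagrange expression in v, up
    to sign. *)
Lemma is_derive_momentum_v (lambda : R) (u v : R -> R) (t : R)
    (Hu : C2_at u t) (Hv : C2_at v t) (Hs : 0 < speed2 u v t) :
  is_derive (momentum_v lambda u v) t
    (Derive u t * cos (u t) * defect lambda u v t / sqrt (speed2 u v t) ^ 3).
Proof.
destruct (C2_at_jet _ _ Hu) as [Hu1 [Hu2 _]].
destruct (C2_at_jet _ _ Hv) as [Hv1 [Hv2 _]].
assert (Hd := is_derive_speed2 _ _ _ Hu Hv).
assert (Hw : 0 < sqrt (speed2 u v t)) by (apply sqrt_lt_R0; trivial).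
unfold momentum_v; auto_derive.
- repeat split; trivial; [eexists; exact Hd | lra].
- eta_reduce.
  rewrite (is_derive_unique _ _ _ Hd).
  unfold defect, curvature_num.
  assert (Ew : sqrt (speed2 u v t) ^ 2 = speed2 u v t) by (rewrite pow2_sqrt //; lra).
  set (w := sqrt (speed2 u v t)) in *.
  field_simplify_eq; [|lra].
  rewrite ?Ew; unfold speed2; ring.
Qed.

Lemma Euler_Lagrange_u_defect (lambda : R) (u v : R -> R) (t : R)
    (Hu : C2_at u t) (Hv : C2_at v t) (Hs : 0 < speed2 u v t) :
  Euler_Lagrange_u (J lambda) u v t <->
  Derive v t * cos (u t) * defect lambda u v t = 0.
Proof.
unfold Euler_Lagrange_u.
rewrite Derive_J_u //.
rewrite (Derive_ext_loc (fun s => Derive _ (Derive u s)) (momentum_u lambda u v)).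
- rewrite (is_derive_unique _ _ _ (is_derive_momentum_u lambda _ _ _ Hu Hv Hs)).
  fold (speed2 u v t).
  assert (Hw : 0 < sqrt (speed2 u v t)) by (apply sqrt_lt_R0; trivial).
  assert (Hw3 := pow_lt _ 3 Hw).
  set (X := Derive v t * cos (u t) * defect lambda u v t).
  set (w := sqrt (speed2 u v t)) in *.
  match goal with |- ?L = 0 <-> _ => replace L with (X / w ^ 3) by (field; lra) end.
  split; intros H.
  + replace X with (X / w ^ 3 * w ^ 3) by (field; lra); rewrite H; ring.
  + rewrite H; field; lra.
- generalize (locally_speed2_pos _ _ _ Hu Hv Hs).
  apply filter_imp; intros s Hss; exact: Derive_J_p.
Qed.

Lemma Euler_Lagrange_v_defect (lambda : R) (u v : R -> R) (t : R)
    (Hu : C2_at u t) (Hv : C2_at v t) (Hs : 0 < speed2 u v t) :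
  Euler_Lagrange_v (J lambda) u v t <->
  Derive u t * cos (u t) * defect lambda u v t = 0.
Proof.
unfold Euler_Lagrange_v.
replace (Derive (fun y => J lambda (u t) y (Derive u t) (Derive v t)) (v t)) with 0
  by (unfold J; rewrite Derive_const //).
rewrite (Derive_ext_loc (fun s => Derive _ (Derive v s)) (momentum_v lambda u v)).
- rewrite (is_derive_unique _ _ _ (is_derive_momentum_v lambda _ _ _ Hu Hv Hs)).
  assert (Hw : 0 < sqrt (speed2 u v t)) by (apply sqrt_lt_R0; trivial).
  assert (Hw3 := pow_lt _ 3 Hw).
  set (X := Derive u t * cos (u t) * defect lambda u v t).
  set (w := sqrt (speed2 u v t)) in *.
  split; intros H.
  + replace X with (- (0 - X / w ^ 3) * w ^ 3) by (field; lra); rewrite H; ring.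
  + rewrite H; field; lra.
- generalize (locally_speed2_pos _ _ _ Hu Hv Hs).
  apply filter_imp; intros s Hss; exact: Derive_J_q.
Qed.

(** * Continuity, dense zeros and the position of the pole *)

Lemma continuous_curvature_num (u v : R -> R) (t : R) (Hu : C2_at u t) (Hv : C2_at v t) :
  continuous (curvature_num u v) t.
Proof.
destruct (C2_at_jet _ _ Hu) as [Hu1 [Hu2 Hu3]].
destruct (C2_at_jet _ _ Hv) as [Hv1 [Hv2 Hv3]].
(* The second derivatives are merely continuous, so they are isolated as factors; all other terms
   are differentiable. *)
apply (continuous_ext (fun s =>
  plus (plus (mult (Derive v s * cos (u s)) (Derive (Derive u) s))
     (mult (- Derive u s * cos (u s)) (Derive (Derive v) s)))
  (Derive v s ^ 3 * sin (u s) * cos (u s) ^ 2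
   + 2 * Derive u s ^ 2 * Derive v s * sin (u s)))).
{ intros s; unfold plus, mult, curvature_num; simpl; ring. }
apply (@continuous_plus _ R_AbsRing R_NormedModule);
  [apply (@continuous_plus _ R_AbsRing R_NormedModule);
    apply (@continuous_mult _ R_AbsRing); trivial|];
  apply (@ex_derive_continuous R_AbsRing R_NormedModule); auto_derive; tauto.
Qed.

Lemma continuous_defect (lambda : R) (u v : R -> R) (t : R)
    (Hu : C2_at u t) (Hv : C2_at v t) :
  continuous (defect lambda u v) t.
Proof.
assert (Hk := continuous_curvature_num _ _ _ Hu Hv).
destruct (C2_at_jet _ _ Hu) as [Hu1 [Hu2 _]].
destruct (C2_at_jet _ _ Hv) as [Hv1 [Hv2 _]].
apply (continuous_ext (fun s =>
  plus (Derive v s * cos (u s) * speed2 u v s)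
    (mult (- (u s + lambda)) (curvature_num u v s)))).
{ intros s; unfold plus, mult, defect; simpl; ring. }
apply (@continuous_plus _ R_AbsRing R_NormedModule);
  [|apply (@continuous_mult _ R_AbsRing); trivial];
  apply (@ex_derive_continuous R_AbsRing R_NormedModule);
  unfold speed2; auto_derive; tauto.
Qed.

(** A nonzero value at t would persist on a ball around t, and this ball meets [a, b] in an interval
    of positive length even when t is an end point. This carries identities to the end points and to
    the zeros of u + lambda. *)
Lemma zero_of_dense_zeros (f : R -> R) (a b t : R) (Hab : a < b) (Ht : a <= t <= b)
    (Hf : continuous f t)
    (Hd : forall x y, a <= x -> x < y -> y <= b -> exists z, x < z < y /\ f z = 0) :
  f t = 0.
Proof.
destruct (Req_dec (f t) 0) as [|Hn]; trivial; exfalso.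
assert (Hl : locally t (fun s => f s <> 0)).
{ apply: (Hf (fun x : R => x <> 0)); exact: (open_neq 0 _ Hn). }
destruct Hl as [eps He].
assert (Hp := cond_pos eps).
destruct (Hd (Rmax a (t - eps)) (Rmin b (t + eps))) as [z [[Hz1 Hz2] Hz]].
- apply Rmax_l.
- apply Rmax_lub_lt; apply Rmin_glb_lt; lra.
- apply Rmin_l.
- apply (He z); trivial.
  apply Rabs_def1; unfold minus, plus, opp; simpl.
  + generalize (Rmin_r b (t + eps)); lra.
  + generalize (Rmax_r a (t - eps)); lra.
Qed.

Lemma Derive_locally_constant (f : R -> R) (c x y t : R) (Ht : x < t < y)
    (Hf : forall s, x < s < y -> f s = c) :
  Derive f t = 0.
Proof.
rewrite (Derive_ext_loc _ (fun _ => c)); [apply Derive_const|].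
generalize (open_and _ _ (open_gt x) (open_lt y) t Ht).
apply: filter_imp; exact Hf.
Qed.

Lemma sin_pos_curve (a b : R) (u v : R -> R) (Hc : curve_in_S2_plus a b u v)
    (t : R) (Ht : a <= t <= b) :
  0 < sin (u t).
Proof. destruct Hc as [_ [_ Hc]]; exact (proj2 (proj2 (Hc t Ht))). Qed.

(* At the pole u is maximal, so an interior passage would have u' = 0 and zero speed. *)
Lemma cos_neq_0_curve (a b : R) (u v : R -> R) (Hc : curve_in_S2_plus a b u v)
    (t : R) (Ht : a < t < b) (Hs : 0 < speed2 u v t) :
  cos (u t) <> 0.
Proof.
intros Hcos.
assert (Htab : a <= t <= b) by lra.
assert (Hsin := sin_pos_curve _ _ _ _ Hc t Htab).
destruct Hc as [Hu [_ Hc]].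
(* A zero of the cosine in the range of u is an end of that range, and z > 0 excludes the lower
   one. *)
assert (Hut : u t = PI / 2).
{ destruct (Hc t Htab) as [[H1 H2] _].
  destruct (Rle_lt_or_eq_dec _ _ H2) as [H3|H3]; trivial; exfalso.
  destruct (Rle_lt_or_eq_dec _ _ H1) as [H4|H4].
  - assert (H5 : - (PI / 2) < u t) by lra.
    generalize (cos_gt_0 _ H5 H3); lra.
  - assert (H5 : u t = - (PI / 2)) by lra.
    rewrite H5 sin_neg sin_PI2 in Hsin; lra. }
destruct (C2_at_jet _ _ (Hu t Htab)) as [Hu1 _].
assert (Hmax : forall x, a < x < b -> u x <= u t).
{ intros x Hx; rewrite Hut; apply Hc; lra. }
assert (H0 := deriv_maximum u a b t (ex_derive_Reals_0 _ _ Hu1)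
  (proj1 Ht) (proj2 Ht) (fun x H H' => Hmax x (conj H H'))).
rewrite Derive_Reals in H0.
unfold speed2 in Hs; rewrite H0 Hcos in Hs; simpl in Hs; lra.
Qed.

(** * Vanishing of the defect along a regular curve on [a, b] *)

Section Curve.

Variables (lambda a b : R) (u v : R -> R).
Hypotheses (Hab : a < b)
  (Hcurve : curve_in_S2_plus a b u v)
  (Hreg : regular a b (fun t => Psi (u t) (v t))).

Lemma C2_at_curve_u (t : R) (Ht : a <= t <= b) : C2_at u t.
Proof. exact (proj1 Hcurve t Ht). Qed.

Lemma C2_at_curve_v (t : R) (Ht : a <= t <= b) : C2_at v t.
Proof. exact (proj1 (proj2 Hcurve) t Ht). Qed.

Local Hint Resolve C2_at_curve_u C2_at_curve_v : core.

Lemma speed2_pos_curve (t : R) (Ht : a <= t <= b) : 0 < speed2 u v t.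
Proof.
exact (speed2_pos _ _ _ (proj1 (C2_at_jet _ _ (C2_at_curve_u t Ht)))
  (proj1 (C2_at_jet _ _ (C2_at_curve_v t Ht))) (Hreg t Ht)).
Qed.

Local Hint Resolve speed2_pos_curve : core.

(** As cos u <> 0 in the interior, a nonzero defect would force u' = v' = 0, against regularity. *)
Lemma defect_eq_0_interior (t : R) (Ht : a < t < b)
    (Hu : Derive u t * cos (u t) * defect lambda u v t = 0)
    (Hv : Derive v t * cos (u t) * defect lambda u v t = 0) :
  defect lambda u v t = 0.
Proof.
assert (Hs : 0 < speed2 u v t) by (apply speed2_pos_curve; lra).
assert (Hc := cos_neq_0_curve _ _ _ _ Hcurve t Ht Hs).
destruct (Req_dec (defect lambda u v t) 0) as [|Hd]; trivial; exfalso.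
assert (Hp : Derive u t = 0).
{ destruct (Rmult_integral _ _ Hu) as [H|H]; [|contradiction].
  destruct (Rmult_integral _ _ H); [trivial|contradiction]. }
assert (Hq : Derive v t = 0).
{ destruct (Rmult_integral _ _ Hv) as [H|H]; [|contradiction].
  destruct (Rmult_integral _ _ H); [trivial|contradiction]. }
unfold speed2 in Hs; rewrite Hp Hq in Hs; simpl in Hs; lra.
Qed.

Lemma spherical_catenary_defect :
  spherical_catenary lambda a b u v <->
  (forall t, a <= t <= b -> defect lambda u v t = 0).
Proof.
split; intros H t Ht.
- apply (zero_of_dense_zeros _ a b); trivial; [apply continuous_defect; auto|].
  (* The midpoint is interior to [a, b]. At an end point the curve may sit at the pole, where both
     equations hold trivially. *)
  intros x y Hx Hxy Hy; exists ((x + y) / 2); split; [lra|].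
  assert (Hz : a <= (x + y) / 2 <= b) by lra.
  destruct (H _ Hz) as [Hu Hv].
  apply defect_eq_0_interior; [lra| |].
  + apply Euler_Lagrange_v_defect in Hv; auto.
  + apply Euler_Lagrange_u_defect in Hu; auto.
- split; [apply Euler_Lagrange_u_defect | apply Euler_Lagrange_v_defect]; auto;
    rewrite H //; ring.
Qed.

(** This is the conservation law for rotations about the z-axis: the derivative of the momentum is a
    multiple of the defect. *)
Lemma momentum_v_constant (Hd : forall t, a <= t <= b -> defect lambda u v t = 0)
    (s t : R) (Hs : a <= s <= b) (Ht : a <= t <= b) :
  momentum_v lambda u v s = momentum_v lambda u v t.
Proof.
assert (H0 : forall r, a <= r <= b -> is_derive (momentum_v lambda u v) r 0).
{ intros r Hr.
  replace 0 with (Derive u r * cos (u r) * defect lambda u v r / sqrt (speed2 u v r) ^ 3).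
  - apply is_derive_momentum_v; auto.
  - rewrite Hd // /Rdiv; ring. }
destruct (Rtotal_order s t) as [Hst|[->|Hst]]; trivial; [|symmetry];
  apply eq_is_derive; trivial; intros r Hr; apply H0; lra.
Qed.

(* Where [u + lambda] vanishes, division by zero turns the curvature equation
   into [kappa_s = 0]. The conserved momentum of [v] is then 0 everywhere, so
   the catenary is an arc of meridian. *)
Lemma curvature_num_eq_0 (Hd : forall t, a <= t <= b -> defect lambda u v t = 0)
    (t : R) (Ht : a <= t <= b) (Hm : u t + lambda = 0) :
  curvature_num u v t = 0.
Proof.
assert (Hv : forall s, a < s < b -> Derive v s = 0).
{ intros s Hs.
  assert (Hs' : a <= s <= b) by lra.
  assert (Hpos := speed2_pos_curve s Hs').
  assert (Hw : sqrt (speed2 u v s) <> 0) by (apply Rgt_not_eq, sqrt_lt_R0; trivial).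
  assert (Hc := cos_neq_0_curve _ _ _ _ Hcurve s Hs Hpos).
  assert (HM := momentum_v_constant Hd s t Hs' Ht).
  unfold momentum_v in HM; rewrite Hm in HM.
  assert (HN : (u s + lambda) * (Derive v s * cos (u s) ^ 2) = 0).
  { replace (_ * _)
      with ((u s + lambda) * Derive v s * cos (u s) ^ 2 / sqrt (speed2 u v s)
            * sqrt (speed2 u v s)) by (field; trivial).
    rewrite HM /Rdiv; ring. }
  (* If u + lambda = 0 at s as well, the zero defect reduces to v' cos u |gamma'|^2 = 0; otherwise
     the zero momentum gives the claim. *)
  assert (Hq : Derive v s * cos (u s) = 0).
  { destruct (Rmult_integral _ _ HN) as [H0|H0].
    - assert (H1 := Hd s Hs'); unfold defect in H1; rewrite H0 in H1.
      assert (H2 : Derive v s * cos (u s) * speed2 u v s = 0) by lra.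
      destruct (Rmult_integral _ _ H2); [trivial|lra].
    - apply (Rmult_eq_reg_r (cos (u s))); trivial; rewrite -> Rmult_0_l, <- H0; ring. }
  destruct (Rmult_integral _ _ Hq); [trivial|contradiction]. }
(* In the interior v' = v'' = 0 makes every term vanish; continuity reaches the end points. *)
apply (zero_of_dense_zeros _ a b); trivial; [apply continuous_curvature_num; auto|].
intros x y Hx Hxy Hy; exists ((x + y) / 2); split; [lra|].
unfold curvature_num.
rewrite (Derive_locally_constant (Derive v) 0 a b) //; [|lra].
rewrite (Hv ((x + y) / 2)); [ring|lra].
Qed.

(* On an arc where [u + lambda] vanishes identically, the junk value would force
   a parallel of positive latitude to have curvature 0. *)
Lemma defect_eq_0
    (HK : forall t, a <= t <= b -> u t + lambda = 0 -> curvature_num u v t = 0)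
    (HR : forall t, a <= t <= b -> u t + lambda <> 0 -> defect lambda u v t = 0)
    (t : R) (Ht : a <= t <= b) :
  defect lambda u v t = 0.
Proof.
apply (zero_of_dense_zeros _ a b); trivial; [apply continuous_defect; auto|].
intros x y Hx Hxy Hy.
apply NNPP; intros Hno.
(* If the defect has no zero in ]x, y[, [HR] leaves only u + lambda = 0 there. *)
assert (Hu : forall s, x < s < y -> u s = - lambda).
{ intros s Hs; destruct (Req_dec (u s + lambda) 0) as [H0|H0]; [lra|].
  exfalso; apply Hno; exists s; split; trivial; apply HR; trivial; lra. }
assert (Hu1 : forall s, x < s < y -> Derive u s = 0).
{ intros s Hs; exact (Derive_locally_constant u _ x y s Hs Hu). }
set (z := (x + y) / 2).
assert (Hz : x < z < y) by (unfold z; lra).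
assert (Hzab : a <= z <= b) by lra.
assert (Hs := speed2_pos_curve z Hzab).
assert (Hc : cos (u z) <> 0) by (apply (cos_neq_0_curve a b u v); trivial; lra).
assert (Hsin := sin_pos_curve _ _ _ _ Hcurve z Hzab).
assert (Hz0 : u z + lambda = 0) by (rewrite Hu //; ring).
assert (H0 := HK z Hzab Hz0).
unfold curvature_num in H0.
rewrite (Derive_locally_constant (Derive u) 0 x y) // Hu1 // in H0.
(* With u' = u'' = 0, [curvature_num] is v'^3 sin u cos^2 u; its vanishing gives v' = 0, hence zero
   speed. *)
assert (Hq : Derive v z = 0).
{ apply NNPP; intros Hq.
  assert (H1 : Derive v z ^ 3 * sin (u z) * cos (u z) ^ 2 <> 0).
  { repeat apply Rmult_integral_contrapositive_currified; trivial;
      try apply pow_nonzero; trivial; lra. }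
  apply H1; rewrite <- H0; ring. }
unfold speed2 in Hs; rewrite Hu1 // Hq in Hs; simpl in Hs; lra.
Qed.

End Curve.

(** * From the defect to the curvature equation *)

Theorem theorem2p2 (lambda a b : R) (u v : R -> R)
    (Hab : a < b)
    (Hcurve : curve_in_S2_plus a b u v)
    (Hreg : regular a b (fun t => Psi (u t) (v t))) :
  spherical_catenary lambda a b u v <->
  (forall t, a <= t <= b ->
     kappa_s (fun s => Psi (u s) (v s)) t =
     Derive v t * cos (u t)
     / ((u t + lambda) * vnorm (vderive (fun s => Psi (u s) (v s)) t))).
Proof.
rewrite (spherical_catenary_defect lambda a b u v Hab Hcurve Hreg).
assert (Heq : forall t, a <= t <= b ->
  kappa_s (fun s => Psi (u s) (v s)) t
    = curvature_num u v t / sqrt (speed2 u v t) ^ 3 /\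
  vnorm (vderive (fun s => Psi (u s) (v s)) t) = sqrt (speed2 u v t) /\
  0 < sqrt (speed2 u v t) /\ sqrt (speed2 u v t) ^ 2 = speed2 u v t).
{ intros t Ht.
  assert (Hu := C2_at_curve_u a b u v Hcurve t Ht).
  assert (Hv := C2_at_curve_v a b u v Hcurve t Ht).
  assert (Hs := speed2_pos_curve a b u v Hcurve Hreg t Ht).
  split; [apply kappa_s_Psi; trivial|].
  split; [unfold vnorm; rewrite dot_vderive_Psi //;
    [exact (proj1 (C2_at_jet _ _ Hu)) | exact (proj1 (C2_at_jet _ _ Hv))]|].
  split; [apply sqrt_lt_R0; trivial|rewrite pow2_sqrt //; lra]. }
split.
- intros Hd t Ht.
  destruct (Heq t Ht) as [-> [-> [Hw Hw2]]].
  destruct (Req_dec (u t + lambda) 0) as [Hm|Hm].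
  (* The denominator is 0 here, so the right-hand side takes the default value 0. *)
  + rewrite (curvature_num_eq_0 lambda a b u v Hab Hcurve Hreg Hd t Ht Hm).
    rewrite Hm Rmult_0_l /Rdiv Rinv_0; ring.
  + assert (H0 := Hd t Ht); unfold defect in H0; rewrite -Hw2 in H0.
    field_simplify_eq; [|split; trivial; lra].
    lra.
(* The curvature equation yields [curvature_num] = 0 where u + lambda = 0, again by the default
   value, and a zero defect elsewhere. *)
- intros Hk; apply defect_eq_0; trivial; intros t Ht Hm;
    assert (H0 := Hk t Ht); destruct (Heq t Ht) as [Hk' [Hn [Hw Hw2]]];
    rewrite Hk' Hn in H0; set (w := sqrt (speed2 u v t)) in *.
  + rewrite Hm Rmult_0_l /Rdiv Rinv_0 Rmult_0_r in H0.
    apply (Rmult_eq_reg_r (/ w ^ 3)); [lra|].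
    apply Rinv_neq_0_compat, pow_nonzero; lra.
  + unfold defect; rewrite -Hw2.
    replace (curvature_num u v t)
      with (Derive v t * cos (u t) / ((u t + lambda) * w) * w ^ 3).
    * field; split; trivial; lra.
    * rewrite -H0; field; lra.
Qed.
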